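(* For any $k,l,n\in\mathbb{N}$, there exists a group $G$ containing free subgroups $A$, $B$ and $F$ such that $\operatorname{rank}(A)=k$, $\operatorname{rank}(B)=l$, $|G:F|=n$, and $$\operatorname{rank}(A\cap B)-1=|G:F|\cdot(\operatorname{rank}(A)-1)\cdot(\operatorname{rank}(B)-1).$$
   Context: Here $\mathbb{N}$ is the set of positive integers, and the subgroups $A$, $B$, $F$ are nontrivial free groups. $\operatorname{rank}(H)$ is the cardinality of a free basis of a free group $H$, and $|G:F|$ is the index of $F$ in $G$. *)

(* Defs.v *)
From mathcomp Require Import all_boot all_algebra.
From mathcomp Require Import mathcomp_extra boolp classical_sets functions cardinality.

Set Implicit Arguments.
Unset Strict Implicit.
Unset Printing Implicit Defensive.

Local Open Scope classical_set_scope.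
Local Open Scope group_scope.

Definition is_subgroup (G : groupType) (H : set G) : Prop :=
  group_closed (mem H).

(* A homomorphism from the subgroup [H] of [G] to [K] is encoded as a function
   on all of [G], whose values outside [H] are irrelevant. *)
Definition hom_on (G K : groupType) (H : set G) (phi : G -> K) : Prop :=
  {in H &, {morph phi : x y / x * y}}.

(* Universal property of free groups: every map from [X] to a group extends
   to exactly one homomorphism on [H]. Maps on [X] are encoded as functions on
   all of [G], whose values outside [X] are irrelevant. *)
Definition is_free_basis (G : groupType) (H X : set G) : Prop :=
  X `<=` H /\
  forall (K : groupType) (f : G -> K),
    (exists phi : G -> K, hom_on H phi /\ {in X, phi =1 f}) /\
    (forall phi psi : G -> K, hom_on H phi -> hom_on H psi ->
       {in X, phi =1 f} -> {in X, psi =1 f} -> {in H, phi =1 psi}).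

Definition is_nontrivial_free_subgroup (G : groupType) (H : set G) : Prop :=
  [/\ is_subgroup H, H <> [set 1] & exists X : set G, is_free_basis H X].

(* All free bases of a free group are equipotent, so at most one [r] satisfies
   this. *)
Definition has_rank (G : groupType) (H : set G) (r : nat) : Prop :=
  exists X : set G, is_free_basis H X /\ (X #= `I_r)%card.

Definition left_coset (G : groupType) (H : set G) (x : G) : set G :=
  [set x * h | h in H].

Definition has_index (G : groupType) (H : set G) (n : nat) : Prop :=
  (range (left_coset H) #= `I_n)%card.

(* Main.v *)
Require Import Defs.
From HB Require Import structures.
From mathcomp Require Import all_boot all_algebra fingroup generic_quotient.
From mathcomp Require Import mathcomp_extra boolp classical_sets functions cardinality.

(** If [G] has a free subgroup of rank 2 and index [n], then rank minus one,
    on free subgroups of finite index, is the index divided by [n].  With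
    [k = p + 1] and [l = q + 1], both [k] and [l] at least 2, it is therefore
    enough to find free subgroups [A] and [B] of [G] of index [np] and [nq]
    whose intersection has the largest possible index, [np * nq].

    Take [G = E * Z/n] with [E] free on [a] and [b], and [F = E * 1].  Let
    [ca] be the exponent sum of [a] modulo [p] and [cb] that of [b] modulo
    [q], in cyclic groups written multiplicatively.  Put
    [A = {(w, 1) | ca w = 1}] and [B = {(w, psi w) | cb w = 1}], where [psi]
    is a morphism from [ker cb] to [Z/n] that sends [b ^+ q] to the generator.
    The intersection is the copy in [E * 1] of the set of [w] with
    [ca w = 1], [cb w = 1] and [psi w = 1], which is reached from [E] by
    taking three kernels in succession: those of [ca], [cb] and [psi], of
    indices [p], [q] and [n].  Each time, some element of the current basis is
    sent to the generator ([a], [b] and [b ^+ q]), and [cyclic_kernel_free]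
    multiplies rank minus one by the order of the cyclic group.  This gives
    the rank [npq + 1] ([realizes_noncyclic]).  When [k = 1] or [l = 1], a
    cyclic subgroup of a free group of rank [l] or [k] does the job
    ([realizes_cyclic]).

    Freeness is handled through the universal property alone, with no reduced
    words.  The free group is the quotient of the words by the relation of
    having equal values in all groups.  Schreier's theorem [schreier_free] is
    proved by passing between morphisms from the kernel of [c : H -> C] to
    [K] and morphisms from [H] to the wreath product of [K] by [C]. *)

Set Implicit Arguments.
Unset Strict Implicit.
Unset Printing Implicit Defensive.

Local Open Scope classical_set_scope.
Local Open Scope group_scope.

(** * Subgroups and homomorphisms on them *)

Lemma is_subgroup1 (G : groupType) (H : set G) : is_subgroup H -> 1 \in H.
Proof. by case. Qed.

Lemma is_subgroupM (G : groupType) (H : set G) x y :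
  is_subgroup H -> x \in H -> y \in H -> x * y \in H.
Proof. by move=> sH; apply: (group_closedM sH). Qed.

Lemma is_subgroupV (G : groupType) (H : set G) x :
  is_subgroup H -> x \in H -> x^-1 \in H.
Proof. by move=> sH; apply: (group_closedV sH). Qed.

Lemma is_subgroupX (G : groupType) (H : set G) x i :
  is_subgroup H -> x \in H -> x ^+ i \in H.
Proof.
move=> sH xH; elim: i => [|i IHi]; first by rewrite expg0 is_subgroup1.
by rewrite expgS is_subgroupM.
Qed.

Lemma is_subgroupT (G : groupType) : is_subgroup [set: G].
Proof. by split=> [|x y _ _]; rewrite in_setT. Qed.

Lemma hom_on1 (G K : groupType) (H : set G) (phi : G -> K) :
  is_subgroup H -> hom_on H phi -> phi 1 = 1.
Proof.
move=> /is_subgroup1 H1 hphi; apply: (mulgI (phi 1)).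
by rewrite -hphi // !mulg1.
Qed.

Lemma hom_onV (G K : groupType) (H : set G) (phi : G -> K) x :
  is_subgroup H -> hom_on H phi -> x \in H -> phi x^-1 = (phi x)^-1.
Proof.
move=> sH hphi xH; apply/esym/mulg1_eq.
by rewrite -hphi ?is_subgroupV // mulgV (hom_on1 sH).
Qed.

Lemma hom_onX (G K : groupType) (H : set G) (phi : G -> K) x i :
  is_subgroup H -> hom_on H phi -> x \in H -> phi (x ^+ i) = phi x ^+ i.
Proof.
move=> sH hphi xH; elim: i => [|i IHi]; first by rewrite !expg0 (hom_on1 sH).
by rewrite !expgS hphi ?is_subgroupX // IHi.
Qed.

Lemma hom_on_sub (G K : groupType) (H H' : set G) (phi : G -> K) :
  H' `<=` H -> hom_on H phi -> hom_on H' phi.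
Proof. by move=> /subsetP sH hphi x y /sH xH /sH yH; apply: hphi. Qed.

Definition hom_kernel (G K : groupType) (H : set G) (c : G -> K) : set G :=
  H `&` [set h | c h = 1].

Lemma in_hom_kernel (G K : groupType) (H : set G) (c : G -> K) h :
  (h \in hom_kernel H c) = (h \in H) && (c h == 1).
Proof. by rewrite in_setI; congr (_ && _); apply/idP/eqP; rewrite inE. Qed.

Lemma is_subgroup_hom_kernel (G K : groupType) (H : set G) (c : G -> K) :
  is_subgroup H -> hom_on H c -> is_subgroup (hom_kernel H c).
Proof.
move=> sH hc; split=> [|x y].
  by rewrite in_hom_kernel is_subgroup1 // (hom_on1 sH) ?eqxx.
rewrite !in_hom_kernel => /andP[xH /eqP cx] /andP[yH /eqP cy].
rewrite is_subgroupM ?is_subgroupV // hc ?is_subgroupV // (hom_onV sH) //.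
by rewrite cx cy mulgV eqxx.
Qed.

Lemma is_subgroup_image (G G' : groupType) (H : set G) (theta : G -> G') :
  is_subgroup H -> hom_on H theta -> is_subgroup (theta @` H).
Proof.
move=> sH ht; split.
  by apply/mem_set; exists 1; [apply/set_mem/is_subgroup1 | exact: hom_on1 ht].
move=> _ _ /set_mem[x /mem_set xH <-] /set_mem[y /mem_set yH <-].
apply/mem_set; exists (x * y^-1).
  by apply/set_mem; rewrite is_subgroupM ?is_subgroupV.
by rewrite ht ?is_subgroupV // (hom_onV sH).
Qed.

(** * Free families *)

(** An indexed form of [is_free_basis]: prescribing values on indices rather
    than on elements of [G] lets injectivity of [x] be a consequence
    ([free_family_inj]), so that no basis needs to be checked for repetitions
    before it is counted. *)
Definition free_family (G : groupType) (H : set G) (J : Type) (x : J -> G) :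
    Prop :=
  [/\ forall j, x j \in H,
      forall (K : groupType) (f : J -> K),
        exists phi : G -> K, hom_on H phi /\ forall j, phi (x j) = f j
    & forall (K : groupType) (phi psi : G -> K),
        hom_on H phi -> hom_on H psi -> (forall j, phi (x j) = psi (x j)) ->
        {in H, phi =1 psi}].

(** A morphism to a group of order 2 can separate any two indices. *)
Lemma free_family_inj (G : groupType) (H : set G) (J : eqType) (x : J -> G) :
  free_family H x -> injective x.
Proof.
move=> [_ xE _] i j xij.
have [phi [_ phix]] := xE 'I_2 (fun k => if k == i then Zp1 else 1).
by have := phix j; rewrite -xij phix eqxx; case: eqVneq.
Qed.

Lemma free_family_neq1 (G : groupType) (H : set G) (J : Type) (x : J -> G) j :
  is_subgroup H -> free_family H x -> x j <> 1.
Proof.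
move=> sH [_ xE _] xj1.
have [phi [hphi /(_ j)]] := xE 'I_2 (fun _ => Zp1).
by rewrite xj1 (hom_on1 sH).
Qed.

Lemma free_basis_range (G : groupType) (H : set G) (J : Type) (x : J -> G) :
  free_family H x -> is_free_basis H (range x).
Proof.
move=> [xH xE xU]; split=> [_ [j _ <-]|K f]; first exact/set_mem.
have Xx j : x j \in range x by apply/mem_set; exists j.
split=> [|phi psi hphi hpsi phif psif].
  have [phi [hphi phix]] := xE K (f \o x).
  by exists phi; split=> // _ /set_mem[j _ <-]; rewrite phix.
by apply: xU => // j; rewrite phif // psif.
Qed.

Lemma card_finType (J : finType) : ([set: J] #= `I_#|J|)%card.
Proof.
have <- : range (fun j : J => enum_rank j : nat) = `I_#|J|.
  apply/seteqP; split=> [_ [j _ <-]|i ltiJ] /=; first exact: ltn_ord.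
  by exists (enum_val (Ordinal ltiJ)); rewrite ?enum_valK.
rewrite card_eq_sym; apply: inj_card_eq => i j _ _ /val_inj.
exact: enum_rank_inj.
Qed.

Lemma free_family_rank (G : groupType) (H : set G) (J : finType) (x : J -> G) r :
  free_family H x -> #|J| = r -> has_rank H r.
Proof.
move=> xF <-; exists (range x); split; first exact: free_basis_range.
apply: (card_eq_trans _ (card_finType J)); apply: inj_card_eq.
by move=> i j _ _; apply: free_family_inj xF i j.
Qed.

Lemma free_family_nontrivial (G : groupType) (H : set G) (J : Type)
    (x : J -> G) (j : J) :
  is_subgroup H -> free_family H x -> is_nontrivial_free_subgroup H.
Proof.
move=> sH xF; split=> //; last by exists (range x); exact: free_basis_range.
move=> H1; have [xH _ _] := xF; have := xH j.
by rewrite H1 => /set_mem /(free_family_neq1 sH xF).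
Qed.

(** The retraction [pi] is asked for on the whole of [G'], so that a morphism
    [phi] on [H] transports to [phi \o pi] on the image; both the graph of a
    morphism on [H] and a cyclic free factor have such a retraction. *)
Lemma free_family_image (G G' : groupType) (H : set G) (J : Type) (x : J -> G)
    (theta : G -> G') (pi : G' -> G) :
    free_family H x -> hom_on H theta -> {morph pi : u v / u * v} ->
    {in H, cancel theta pi} ->
  free_family (theta @` H) (theta \o x).
Proof.
move=> [xH xE xU] ht hpi tK.
have tH h : h \in H -> theta h \in theta @` H.
  by move=> hH; apply/mem_set; exists h => //; apply/set_mem.
split=> [j|K f|K phi psi hphi hpsi phi_psi]; first exact/tH/xH.
  have [phi [hphi phix]] := xE K f; exists (phi \o pi).
  split=> [|j] /=; last by rewrite tK ?phix.
  move=> _ _ /set_mem[u /mem_set uH <-] /set_mem[v /mem_set vH <-] /=.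
  by rewrite hpi hphi ?tK.
move=> _ /set_mem[h /mem_set hH <-].
apply: (xU _ (phi \o theta) (psi \o theta)) => // u v uH vH /=; rewrite ht //.
  by rewrite hphi ?tH.
by rewrite hpsi ?tH.
Qed.

(** * Free groups as words modulo equality in all groups *)

(** The boolean is [true] on the letters that stand for an inverse. *)
Definition word (J : choiceType) := seq (J * bool).

Definition eval_word (J : choiceType) (K : groupType) (f : J -> K)
    (w : word J) : K :=
  \prod_(a <- w) (if a.2 then (f a.1)^-1 else f a.1).

Lemma eval_word_cat (J : choiceType) (K : groupType) (f : J -> K) (v w : word J) :
  eval_word f (v ++ w) = eval_word f v * eval_word f w.
Proof. exact: big_cat. Qed.

Definition inv_word (J : choiceType) (w : word J) : word J :=
  rev [seq (a.1, ~~ a.2) | a <- w].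

Lemma eval_inv_word (J : choiceType) (K : groupType) (f : J -> K) (w : word J) :
  eval_word f (inv_word w) = (eval_word f w)^-1.
Proof.
rewrite /eval_word /inv_word -[w in RHS]revK -prodgV -map_rev big_map.
by apply: eq_bigr => -[j []] _ //=; rewrite invgK.
Qed.

(** Quantifying over all groups makes the universal property and the group
    laws immediate, since both are detected by evaluations. *)
Definition equal_words (J : choiceType) : rel (word J) := fun v w =>
  `[< forall (K : groupType) (f : J -> K), eval_word f v = eval_word f w >].

Lemma equal_words_refl (J : choiceType) : reflexive (@equal_words J).
Proof. by move=> w; apply/asboolP. Qed.

Lemma equal_words_sym (J : choiceType) : symmetric (@equal_words J).
Proof. by move=> v w; apply/asboolP/asboolP => vw K f; rewrite vw. Qed.

Lemma equal_words_trans (J : choiceType) : transitive (@equal_words J).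
Proof.
by move=> v u w /asboolP uv /asboolP vw; apply/asboolP => K f; rewrite uv.
Qed.

Canonical equal_words_equiv (J : choiceType) :=
  EquivRel (@equal_words J) (@equal_words_refl J) (@equal_words_sym J)
    (@equal_words_trans J).

Definition free_group (J : choiceType) : Type := {eq_quot (@equal_words J)}%qT.

HB.instance Definition _ (J : choiceType) := Choice.on (free_group J).
HB.instance Definition _ (J : choiceType) := EqQuotient.on (free_group J).

Definition word_class (J : choiceType) (w : word J) : free_group J :=
  (\pi_(free_group J) w)%qT.

Definition eval (J : choiceType) (K : groupType) (f : J -> K)
    (g : free_group J) : K :=
  eval_word f (repr g).

Lemma eval_class (J : choiceType) (K : groupType) (f : J -> K) (w : word J) :
  eval f (word_class w) = eval_word f w.
Proof.
have /eqmodP/asboolP : (repr (word_class w) = w %[mod free_group J])%qT.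
  by rewrite reprK.
exact.
Qed.

(** All group laws of [free_group] follow from this separation property. *)
Lemma eval_inj (J : choiceType) (g h : free_group J) :
  (forall (K : groupType) (f : J -> K), eval f g = eval f h) -> g = h.
Proof.
by move=> gh; rewrite -[g]reprK -[h]reprK; apply/eqmodP/asboolP.
Qed.

Definition free_one (J : choiceType) : free_group J := word_class [::].
Definition free_mul (J : choiceType) (g h : free_group J) : free_group J :=
  word_class (repr g ++ repr h).
Definition free_inv (J : choiceType) (g : free_group J) : free_group J :=
  word_class (inv_word (repr g)).

Lemma eval1 (J : choiceType) (K : groupType) (f : J -> K) :
  eval f (free_one J) = 1.
Proof. by rewrite eval_class /eval_word big_nil. Qed.

Lemma evalM (J : choiceType) (K : groupType) (f : J -> K) g h :
  eval f (free_mul g h) = eval f g * eval f h.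
Proof. by rewrite eval_class eval_word_cat. Qed.

Lemma evalV (J : choiceType) (K : groupType) (f : J -> K) g :
  eval f (free_inv g) = (eval f g)^-1.
Proof. by rewrite eval_class eval_inv_word. Qed.

Lemma free_mulA (J : choiceType) : associative (@free_mul J).
Proof. by move=> g h i; apply: eval_inj => K f; rewrite !evalM mulgA. Qed.
Lemma free_mul1g (J : choiceType) : left_id (free_one J) (@free_mul J).
Proof. by move=> g; apply: eval_inj => K f; rewrite evalM eval1 mul1g. Qed.
Lemma free_mulg1 (J : choiceType) : right_id (free_one J) (@free_mul J).
Proof. by move=> g; apply: eval_inj => K f; rewrite evalM eval1 mulg1. Qed.
Lemma free_mulVg (J : choiceType) :
  left_inverse (free_one J) (@free_inv J) (@free_mul J).
Proof. by move=> g; apply: eval_inj => K f; rewrite evalM evalV eval1 mulVg. Qed.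
Lemma free_mulgV (J : choiceType) :
  right_inverse (free_one J) (@free_inv J) (@free_mul J).
Proof. by move=> g; apply: eval_inj => K f; rewrite evalM evalV eval1 mulgV. Qed.

HB.instance Definition _ (J : choiceType) := isGroup.Build (free_group J)
  (@free_mulA J) (@free_mul1g J) (@free_mulg1 J)
  (@free_mulVg J) (@free_mulgV J).

Definition gen (J : choiceType) (j : J) : free_group J :=
  word_class [:: (j, false)].

Lemma eval_gen (J : choiceType) (K : groupType) (f : J -> K) j :
  eval f (gen j) = f j.
Proof. by rewrite eval_class /eval_word big_seq1. Qed.

Lemma hom_eval (J : choiceType) (K : groupType) (f : J -> K) :
  {morph eval f : g h / g * h}.
Proof. by move=> g h; apply: evalM. Qed.

(** A word is a product of generators and their inverses, so a morphism is
    determined by its values on the generators. *)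
Lemma hom_free_groupE (J : choiceType) (K : groupType) (phi : free_group J -> K) :
  {morph phi : g h / g * h} -> phi =1 eval (phi \o @gen J).
Proof.
move=> phiM g.
have hphi : hom_on setT phi by move=> u v _ _.
rewrite /eval; set w := repr g.
have -> : g = word_class w by rewrite /word_class reprK.
have classM u v : word_class (u ++ v) = word_class u * word_class v :> free_group J.
  by apply: eval_inj => K' f; rewrite hom_eval !eval_class eval_word_cat.
elim: w => [|[j b] w IHw].
  by rewrite /eval_word big_nil; apply: hom_on1 hphi; apply: is_subgroupT.
rewrite -cat1s classM phiM eval_word_cat IHw; congr (_ * _).
rewrite /eval_word big_seq1 /=; case: b => //.
have -> : word_class [:: (j, true)] = (gen j)^-1 :> free_group J.
  apply: eval_inj => K' f.
  by rewrite [RHS]evalV !eval_class /eval_word !big_seq1.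
by apply: hom_onV (is_subgroupT _) hphi _; rewrite in_setT.
Qed.

Lemma free_family_gen (J : choiceType) : free_family setT (@gen J).
Proof.
split=> [j|K f|K phi psi hphi hpsi phi_psi g _]; first by rewrite in_setT.
  by exists (eval f); split=> [g h _ _|j]; [apply: hom_eval | apply: eval_gen].
rewrite hom_free_groupE => [|u v]; last by rewrite hphi ?in_setT.
rewrite [RHS]hom_free_groupE => [|u v]; last by rewrite hpsi ?in_setT.
by congr (eval _ g); apply: funext => j /=.
Qed.

(** * Wreath products *)

(** [K ^ C] extended by [C], which acts by translating the arguments: the
    target of the morphism induced by a morphism to [K] defined on the kernel
    of a morphism to [C]. *)
Definition wreath (C : finGroupType) (K : groupType) : Type :=
  ({ffun C -> K} * C)%type.

HB.instance Definition _ (C : finGroupType) (K : groupType) :=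
  Choice.on (wreath C K).

Definition wreath_one (C : finGroupType) (K : groupType) : wreath C K :=
  ([ffun=> 1], 1).
Definition wreath_mul (C : finGroupType) (K : groupType) (u v : wreath C K) :
    wreath C K :=
  ([ffun i => u.1 i * v.1 (i * u.2)], u.2 * v.2).
Definition wreath_inv (C : finGroupType) (K : groupType) (u : wreath C K) :
    wreath C K :=
  ([ffun i => (u.1 (i * u.2^-1))^-1], u.2^-1).

Lemma wreath_mulA (C : finGroupType) (K : groupType) :
  associative (@wreath_mul C K).
Proof.
move=> u v w; congr (_, _); last exact: mulgA.
by apply/ffunP => i; rewrite !ffunE /= !mulgA.
Qed.

Lemma wreath_mul1g (C : finGroupType) (K : groupType) :
  left_id (wreath_one C K) (@wreath_mul C K).
Proof.
move=> [u s]; congr (_, _); last exact: mul1g.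
by apply/ffunP => i; rewrite !ffunE /= mul1g mulg1.
Qed.

Lemma wreath_mulg1 (C : finGroupType) (K : groupType) :
  right_id (wreath_one C K) (@wreath_mul C K).
Proof.
move=> [u s]; congr (_, _); last exact: mulg1.
by apply/ffunP => i; rewrite !ffunE /= mulg1.
Qed.

Lemma wreath_mulVg (C : finGroupType) (K : groupType) :
  left_inverse (wreath_one C K) (@wreath_inv C K) (@wreath_mul C K).
Proof.
move=> [u s]; congr (_, _); last exact: mulVg.
by apply/ffunP => i; rewrite !ffunE /= mulVg.
Qed.

Lemma wreath_mulgV (C : finGroupType) (K : groupType) :
  right_inverse (wreath_one C K) (@wreath_inv C K) (@wreath_mul C K).
Proof.
move=> [u s]; congr (_, _); last exact: mulgV.
by apply/ffunP => i; rewrite !ffunE /= mulgK mulgV.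
Qed.

HB.instance Definition _ (C : finGroupType) (K : groupType) :=
  isGroup.Build (wreath C K) (@wreath_mulA C K) (@wreath_mul1g C K)
    (@wreath_mulg1 C K) (@wreath_mulVg C K) (@wreath_mulgV C K).

(** * Schreier bases of kernels *)

(** The monomial (Kaloujnine-Krasner) form of induction: [t] is a section of
    [c], and the coordinate [i] of the image of [h] is the value of [phi] on
    the element of the kernel of [c] obtained by carrying [h] from the coset
    of [t i] to that of [t (i * c h)]. *)
Definition induced_hom (C : finGroupType) (G K : groupType) (c : G -> C)
    (t : C -> G) (phi : G -> K) (h : G) : wreath C K :=
  ([ffun i => phi (t i * h * (t (i * c h))^-1)], c h).

Definition schreier_gen (C : finGroupType) (G : groupType) (J : Type)
    (x : J -> G) (c : G -> C) (t : C -> G) (e : C * J) : G :=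
  t e.1 * x e.2 * (t (e.1 * c (x e.2)))^-1.

Lemma schreier_in_kernel (C : finGroupType) (G : groupType) (H : set G)
    (c : G -> C) (t : C -> G) (i : C) (h : G) :
    is_subgroup H -> hom_on H c -> (forall i, t i \in H) ->
    (forall i, c (t i) = i) -> h \in H ->
  t i * h * (t (i * c h))^-1 \in hom_kernel H c.
Proof.
move=> sH hc tH ct hH; rewrite in_hom_kernel.
rewrite !is_subgroupM ?is_subgroupV // hc ?is_subgroupM ?is_subgroupV //.
by rewrite hc // (hom_onV sH) // !ct mulgV eqxx.
Qed.

Lemma hom_on_induced (C : finGroupType) (G K : groupType) (H : set G)
    (c : G -> C) (t : C -> G) (phi : G -> K) :
    is_subgroup H -> hom_on H c -> (forall i, t i \in H) ->
    (forall i, c (t i) = i) -> hom_on (hom_kernel H c) phi ->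
  hom_on H (induced_hom c t phi).
Proof.
move=> sH hc tH ct hphi g h gH hH; rewrite /induced_hom hc //.
congr (_, _); apply/ffunP => i; rewrite !ffunE /=.
rewrite -hphi ?(schreier_in_kernel _ sH) //.
by congr phi; rewrite !mulgA mulgVK.
Qed.

(** Schreier's theorem for the kernel of [c : H -> C], where [tree] is a
    spanning tree, rooted at [1], of the graph with vertices [C] and edges
    [(i, j) : i -> i * c (x j)], along which the transversal [t] is built.
    The generators outside the tree are a free family.

    Values [f] of the generators, completed by [1] on the tree, define by the
    universal property of [H] a morphism [Phi] to the wreath product; its
    coordinate at [1] is multiplicative on the kernel, is trivial on the
    transversal because the tree carries the value [1], and so takes the
    prescribed values.  Conversely a morphism on the kernel is the coordinate
    at [1] of its induced morphism, which its values on the generators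
    determine. *)
Lemma schreier_free (C : finGroupType) (G : groupType) (H : set G)
    (J : choiceType) (x : J -> G) (c : G -> C) (t : C -> G) (tree : pred (C * J)) :
    is_subgroup H -> free_family H x -> hom_on H c ->
    (forall i, t i \in H) -> (forall i, c (t i) = i) -> t 1 = 1 ->
    (forall i j, tree (i, j) -> t i * x j = t (i * c (x j))) ->
    (forall P : C -> Prop, P 1 ->
       (forall i j, tree (i, j) -> P i -> P (i * c (x j))) -> forall i, P i) ->
  free_family (hom_kernel H c)
    (fun e : {e : C * J | ~~ tree e} => schreier_gen x c t (val e)).
Proof.
move=> sH [xH xE xU] hc tH ct t1 treeE tree_ind.
split=> [e|K f|K phi psi hphi hpsi eq_gen].
- exact: (schreier_in_kernel _ sH).
- pose F e := if insub e is Some e' then f e' else 1.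
  have [Phi [hPhi Phix]] :=
    xE (wreath C K) (fun j => ([ffun i => F (i, j)], c (x j))).
  have Phi2 : {in H, forall h, (Phi h).2 = c h}.
    apply: (xU _ (fun h => (Phi h).2) c) => // [g h gH hH|j]; last by rewrite Phix.
    by rewrite hPhi.
  have PhiM g h i : g \in H -> h \in H ->
      (Phi (g * h)).1 i = (Phi g).1 i * (Phi h).1 (i * c g).
    by move=> gH hH; rewrite hPhi // ffunE Phi2.
  have Phi_t i : (Phi (t i)).1 1 = 1.
    move: i; apply: tree_ind => [|i j tree_ij IHi].
      by rewrite t1 (hom_on1 sH) // ffunE.
    rewrite -treeE // PhiM // IHi mul1g ct mul1g Phix ffunE /F insubN ?negbK //.
  exists (fun h => (Phi h).1 1); split=> [g h|e].
    rewrite !in_hom_kernel => /andP[gH /eqP cg] /andP[hH _].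
    by rewrite PhiM // cg mulg1.
  set s := schreier_gen _ _ _ _.
  have : s \in hom_kernel H c by apply: (schreier_in_kernel _ sH).
  rewrite in_hom_kernel => /andP[sHs /eqP cs].
  pose i := (val e).1; pose j := (val e).2.
  have : s * t (i * c (x j)) = t i * x j by rewrite /s /schreier_gen mulgVK.
  clearbody s => /(congr1 (fun h => (Phi h).1 1)) /=.
  rewrite !PhiM // cs ct mulg1 !Phi_t mulg1 !mul1g.
  by move=> ->; rewrite Phix ffunE /F -surjective_pairing valK.
have eq_on : {in H, induced_hom c t phi =1 induced_hom c t psi}.
  apply: xU => [||j]; [exact: hom_on_induced..|].
  congr (_, _); apply/ffunP => i; rewrite !ffunE.
  have [tree_ij|ntree] := boolP (tree (i, j)); last first.
    exact: (eq_gen (exist _ (i, j) ntree)).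
  have sK := is_subgroup_hom_kernel sH hc.
  by rewrite treeE // mulgV (hom_on1 sK hphi) (hom_on1 sK hpsi).
move=> h; rewrite in_hom_kernel => /andP[hH /eqP ch].
have := congr1 (fun u : wreath C K => u.1 1) (eq_on h hH).
by rewrite !ffunE ch mulg1 t1 invg1 mul1g mulg1.
Qed.

(** The transversal is [x j0 ^+ i] for [i <= m], with tree the edges labelled
    [j0] that leave [i < m].  There remain the edge [(m, j0)], which gives the
    basis element [x j0 ^+ m.+1], and [m.+1] edges for each [j != j0].  The
    last two conclusions give names to the elements to which the lemma is
    applied again. *)
Lemma cyclic_kernel_free (m : nat) (G : groupType) (H : set G) (J : finType)
    (x : J -> G) (c : G -> 'I_m.+1) (j0 : J) :
    is_subgroup H -> free_family H x -> hom_on H c -> c (x j0) = inZp 1 ->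
  exists (J' : finType) (x' : J' -> G),
    [/\ free_family (hom_kernel H c) x', #|J'| = (m.+1 * #|J|.-1).+1,
        (exists j', x' j' = x j0 ^+ m.+1)
      & forall j, j != j0 -> c (x j) = 1 -> exists j', x' j' = x j].
Proof.
move=> sH xF hc cx0; have [xH _ _] := xF.
pose t (i : 'I_m.+1) := x j0 ^+ i.
pose tree := [pred e : 'I_m.+1 * J | (e.1 != ord_max) && (e.2 == j0)].
have tH i : t i \in H by apply: is_subgroupX.
have cX k : c (x j0 ^+ k) = inZp k.
  by rewrite (hom_onX _ sH) // cx0 Zp_expg; apply/val_inj; rewrite /= modnMml mul1n.
have ct i : c (t i) = i by rewrite cX valZpK.
have succ (i : 'I_m.+1) : i != ord_max -> (i * c (x j0) = i.+1 :> nat)%g.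
  move=> im; have lti : (i.+1 < m.+1)%N.
    rewrite ltn_neqAle ltn_ord andbT eqSS; apply: contraNneq im => im.
    exact/eqP/val_inj.
  by rewrite cx0 /= modnDmr addn1 modn_small.
have treeE i j : tree (i, j) -> t i * x j = t (i * c (x j)).
  by move=> /andP[/= /succ Si /eqP ->]; rewrite /t Si expgSr.
have tree_ind (P : 'I_m.+1 -> Prop) : P 1 ->
    (forall i j, tree (i, j) -> P i -> P (i * c (x j))) -> forall i, P i.
  move=> P1 PS i; have [k] := ubnP (i : nat); elim: k i => // k IHk i ltik.
  have [i0|i_gt0] := posnP i; first by have -> : i = 1 by apply: val_inj.
  have lti' : (i.-1 < m.+1)%N by rewrite (leq_ltn_trans (leq_pred i)).
  pose i' := Ordinal lti'.
  have i'max : i' != ord_max.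
    apply/eqP => /(congr1 val) /= im; have := ltn_ord i.
    by rewrite -(prednK i_gt0) im ltnn.
  have -> : i = i' * c (x j0) by apply: val_inj; rewrite [RHS]succ //= prednK.
  by apply: PS; [rewrite /= i'max eqxx | apply: IHk; rewrite /= -ltnS prednK].
exists {e : 'I_m.+1 * J | ~~ tree e}, (fun e => schreier_gen x c t (val e)); split.
- exact: schreier_free.
- rewrite card_sig.
  have card_tree : #|tree| = m.
    have -> : #|tree| = #|predX (predC1 (@ord_max m)) (pred1 j0)| by apply: eq_card.
    by rewrite cardX cardC1 card1 card_ord muln1.
  have := cardC tree; rewrite card_tree card_prod card_ord => eqn.
  have J_gt0 : (0 < #|J|)%N by apply/card_gt0P; exists j0.
  have -> : #|[pred e | ~~ tree e]| = #|[predC tree]| by apply: eq_card.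
  by apply/(@addnI m); rewrite eqn addnS -addSn -mulnS prednK.
- have ntree : ~~ tree (ord_max, j0) by rewrite /= eqxx.
  exists (exist _ (ord_max, j0) ntree); rewrite /schreier_gen /= -expgSr /=.
  have -> : (ord_max : 'I_m.+1) * c (x j0) = 1.
    by apply/val_inj; rewrite cx0 /= modnDmr addn1 modnn.
  by rewrite invg1 mulg1.
move=> j jj0 cxj; have ntree : ~~ tree (1, j) by rewrite /= negb_and jj0 orbT.
exists (exist _ (1, j) ntree); rewrite /schreier_gen /= cxj mulg1 /t.
by rewrite expg0 invg1 mulg1 mul1g.
Qed.

(** * The construction *)

Lemma index_hom_kernel (G : groupType) (C : finGroupType) (pi : G -> C)
    (s : C -> G) :
    {morph pi : g h / g * h} -> cancel s pi ->
  has_index (hom_kernel setT pi) #|C|.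
Proof.
move=> piM sK; rewrite /has_index.
have hpi : hom_on setT pi by move=> g h _ _.
have sT := is_subgroupT G.
have cosetE g : left_coset (hom_kernel setT pi) g = [set g' | pi g' = pi g].
  apply/seteqP; split=> [_ [h [_ /= ph] <-]|g' /= pg].
    by rewrite /= piM ph mulg1.
  exists (g^-1 * g'); last by rewrite mulVKg.
  by split=> //=; rewrite piM (hom_onV sT hpi) ?in_setT // pg mulVg.
have -> : range (left_coset (hom_kernel setT pi)) = range (fun c => [set g | pi g = c]).
  apply/seteqP; split=> [_ [g _ <-]|_ [c _ <-]]; first by exists (pi g).
  by exists (s c); rewrite // cosetE sK.
apply: (card_eq_trans _ (card_finType C)); apply: inj_card_eq => c d _ _ cd.
by have : [set g | pi g = c] (s c) by []; rewrite cd /= sK.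
Qed.

(** The data of the theorem, with the rank [r] of the intersection as a
    parameter; this form is symmetric in [k] and [l]. *)
Definition realizes (k l r n : nat) : Prop :=
  exists (G : groupType) (A B F : set G),
    [/\ is_nontrivial_free_subgroup A, is_nontrivial_free_subgroup B &
        is_nontrivial_free_subgroup F] /\
    [/\ has_rank A k, has_rank B l & has_index F n] /\ has_rank (A `&` B) r.

Lemma realizes_sym k l r n : realizes k l r n -> realizes l k r n.
Proof.
move=> [G [A [B [F [[fA fB fF] [[rA rB iF] rAB]]]]]].
by exists G, B, A, F; rewrite setIC.
Qed.

Lemma kernel_snd (G K : groupType) :
  hom_kernel setT (fun u : G * K => u.2) = (fun g : G => (g, 1 : K)) @` setT.
Proof.
apply/seteqP; split=> [[g z] [_ /= ->]|_ [g _ <-]]; first by exists g.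
by split.
Qed.

(** [B] is the free factor of [E * Z/n] with [E] of rank [l], and [A] the
    infinite cyclic subgroup of [B] generated by one basis element. *)
Lemma realizes_cyclic l n : (0 < l)%N -> (0 < n)%N -> realizes 1 l 1 n.
Proof.
case: l n => // l [//|n] _ _.
pose E := free_group 'I_l.+1; pose G : groupType := (E * 'I_n.+1)%type.
pose inj (w : E) : G := (w, 1).
have inj_hom : hom_on setT inj by move=> v w _ _; rewrite /inj; congr (_, _); rewrite mulg1.
have fstM : {morph (fun u : G => u.1) : u v / u * v} by [].
pose B : set G := inj @` setT.
have sB : is_subgroup B by apply: is_subgroup_image (is_subgroupT _) inj_hom.
have fB : free_family B (inj \o @gen 'I_l.+1).
  exact: (free_family_image (@free_family_gen _) inj_hom fstM).
pose iota : free_group unit -> G := inj \o eval (fun _ => gen ord0).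
pose rho : G -> free_group unit := fun u => eval (fun _ => gen tt) u.1.
have iota_hom : hom_on setT iota.
  by move=> v w _ _; rewrite /iota /= hom_eval inj_hom ?in_setT.
have rhoM : {morph rho : u v / u * v} by move=> u v; rewrite /rho hom_eval.
have iotaK : {in setT, cancel iota rho}.
  have [_ _ genU] := @free_family_gen unit.
  apply: (genU _ (rho \o iota) id) => // [v w vT wT|[]] /=.
    by rewrite iota_hom.
  by rewrite /rho /iota /= !eval_gen.
pose A : set G := iota @` setT.
have sA : is_subgroup A by apply: is_subgroup_image (is_subgroupT _) iota_hom.
have fA : free_family A (iota \o @gen unit).
  exact: (free_family_image (@free_family_gen _) iota_hom rhoM).
have AB : A `&` B = A by apply/setIidPl => _ [w _ <-]; eexists.
exists G, A, B, B; rewrite AB; split; last split.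
- by split; [exact: (free_family_nontrivial tt) fA|exact: (free_family_nontrivial ord0) fB..].
- split; [exact: free_family_rank fA (card_unit)|exact: free_family_rank fB (card_ord _)|].
  rewrite /B -kernel_snd -[X in has_index _ X](card_ord n.+1).
  exact: (index_hom_kernel (s := fun z => (1, z))).
exact: free_family_rank fA (card_unit).
Qed.

(** [JA], [JB], [JC], [JD] index bases of [ker ca], of [ker cb], of their
    intersection [C], and of the kernel of [psi] on [C].  The power [b ^+ q]
    belongs both to the basis of [ker cb], where [psi] can be prescribed, and
    to the basis of [C], where it allows one more cyclic kernel. *)
Lemma realizes_noncyclic p q n : (0 < p)%N -> (0 < q)%N -> (0 < n)%N ->
  realizes p.+1 q.+1 (n * (p * q)).+1 n.
Proof.
case: p q n => // p [//|q] [//|n] _ _ _.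
pose E := free_group bool; pose G : groupType := (E * 'I_n.+1)%type.
pose a : E := gen true; pose b : E := gen false.
pose ca : E -> 'I_p.+1 := eval (fun j => if j then inZp 1 else 1).
pose cb : E -> 'I_q.+1 := eval (fun j => if j then 1 else inZp 1).
have hca (H : set E) : hom_on H ca by move=> v w _ _; apply: hom_eval.
have hcb (H : set E) : hom_on H cb by move=> v w _ _; apply: hom_eval.
have caa : ca a = inZp 1 by rewrite /ca eval_gen.
have cab : ca b = 1 by rewrite /ca eval_gen.
have cbb : cb b = inZp 1 by rewrite /cb eval_gen.
have sE := is_subgroupT E.
have fE := @free_family_gen bool.
pose A0 := hom_kernel setT ca; pose B0 := hom_kernel setT cb.
have sA0 : is_subgroup A0 by apply: is_subgroup_hom_kernel.
have sB0 : is_subgroup B0 by apply: is_subgroup_hom_kernel.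
have [JA [xA [fA0 cardA _ xAE]]] := cyclic_kernel_free sE fE (hca _) caa.
have [jA xAb] := xAE false isT cab.
have [JB [xB [fB0 cardB [jB xBb] _]]] :=
  cyclic_kernel_free sE fE (hcb _) cbb.
pose C := hom_kernel A0 cb.
have sC : is_subgroup C by apply: is_subgroup_hom_kernel.
have cbA : cb (xA jA) = inZp 1 by rewrite xAb.
have [JC [xC [fC cardC [jC xCb] _]]] := cyclic_kernel_free sA0 fA0 (hcb _) cbA.
have [_ xBE _] := fB0.
have [psi [hpsi psix]] := xBE 'I_n.+1 (fun _ => inZp 1).
have hpsiC : hom_on C psi by apply: hom_on_sub hpsi => w [].
have psiC : psi (xC jC) = inZp 1 by rewrite xCb xAb -[_ ^+ _]xBb psix.
have [JD [xD [fD cardD _ _]]] := cyclic_kernel_free sC fC hpsiC psiC.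
pose thA (w : E) : G := (w, 1); pose thB (w : E) : G := (w, psi w).
have thA_hom H : hom_on H thA by move=> v w _ _; rewrite /thA; congr (_, _); rewrite mulg1.
have thB_hom : hom_on B0 thB by move=> v w vB wB; rewrite /thB hpsi.
have fstM : {morph (fun u : G => u.1) : u v / u * v} by [].
have fF : free_family (thA @` setT) (thA \o @gen bool).
  exact: (free_family_image fE (thA_hom _) fstM).
have fA : free_family (thA @` A0) (thA \o xA).
  exact: (free_family_image fA0 (thA_hom _) fstM).
have fB : free_family (thB @` B0) (thB \o xB).
  exact: (free_family_image fB0 thB_hom fstM).
have fAB : free_family (thA @` hom_kernel C psi) (thA \o xD).
  exact: (free_family_image fD (thA_hom _) fstM).
have ABE : (thA @` A0) `&` (thB @` B0) = thA @` hom_kernel C psi.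
  apply/seteqP; split=> [_ [[w wA <-] [v vB [vw psiv]]]|_ [w [[wA /= cbw] psiw] <-]].
    by move: vw psiv vB => -> psiw [_ cbw]; exists w.
  by split; [exists w | exists w; rewrite // /thB psiw].
exists G, (thA @` A0), (thB @` B0), (thA @` setT); rewrite ABE; split; last split.
- split; [apply: (free_family_nontrivial jA) fA|apply: (free_family_nontrivial jB) fB|
          apply: (free_family_nontrivial true) fF]; exact: is_subgroup_image.
- split; [apply: free_family_rank fA _|apply: free_family_rank fB _|].
  + by rewrite cardA card_bool muln1.
  + by rewrite cardB card_bool muln1.
  rewrite -kernel_snd -[X in has_index _ X](card_ord n.+1).
  exact: (index_hom_kernel (s := fun z => (1, z))).
apply: free_family_rank fAB _.
by rewrite cardD cardC cardA card_bool muln1 [(p.+1 * _)%N]mulnC.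
Qed.

Local Open Scope ring_scope.

Theorem mainTheorem3 (k l n : nat) (hk : (0 < k)%N) (hl : (0 < l)%N)
    (hn : (0 < n)%N) :
  exists (G : groupType) (A B F : set G),
    [/\ is_nontrivial_free_subgroup A,
        is_nontrivial_free_subgroup B &
        is_nontrivial_free_subgroup F] /\
    [/\ has_rank A k, has_rank B l & has_index F n] /\
    exists r : nat, has_rank (A `&` B) r /\
      r%:Z - 1 = n%:Z * (k%:Z - 1) * (l%:Z - 1).
Proof.
have succB (m : nat) : m.+1%:Z - 1 = m%:Z by rewrite -addn1 PoszD GRing.addrK.
suff [G [A [B [F [? [? rAB]]]]]] : realizes k l (n * (k.-1 * l.-1)).+1 n.
  exists G, A, B, F; do 2!split=> //; exists (n * (k.-1 * l.-1)).+1; split=> //.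
  by rewrite -{2}(prednK hk) -{2}(prednK hl) !succB !PoszM GRing.mulrA.
case: k l hk hl => [//|[|p]] [//|[|q]] _ _ /=.
- by rewrite !muln0; exact: realizes_cyclic.
- by rewrite mul0n muln0; exact: realizes_cyclic.
- by rewrite !muln0; apply/realizes_sym/realizes_cyclic.
- exact: realizes_noncyclic.
Qed.
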